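(* For each integer $b\ge1$, let $L_b^{\mathrm{box}}=\{w\in\{0,1\}^*\mid |w|_0=|w|_1=2b,\ \forall k\in\{1,\dots,b\}:\ \delta_{k,k}^{2b}(w)\in\{0101,1010,0110,1001\}\}$. Then $L_b^{\mathrm{box}}$ is $2b$-uniform and $\mathcal{G}_{L_b^{\mathrm{box}}}$ is exactly the class of graphs of boxicity at most $b$.
   Context: $|w|_a$ is the number of occurrences of letter $a$ in $w$; a binary word is $k$-uniform if it has exactly $k$ occurrences of $0$ and of $1$. For a $2b$-uniform binary word $w$ and $k\in\{1,\dots,b\}$, $\delta_{k,k}^{2b}(w)$ is obtained from $w$ by deleting all occurrences of $0$ except the $(2k-1)$-st and $2k$-th, and all occurrences of $1$ except the $(2k-1)$-st and $2k$-th. For a word $w$ and distinct letters $a,b$, $h_{a,b}(w)$ replaces $a$ by $0$, $b$ by $1$ and deletes other letters. For $L\subseteq\{0,1\}^*$ closed under exchanging $0$ and $1$ and a word $w$ with letter set $V$, $G(L,w)$ is the graph on $V$ where distinct $u,v$ are adjacent iff $h_{u,v}(w)\in L$; $\mathcal{G}_L$ is the class of graphs isomorphic to some $G(L,w)$. A graph has boxicity at most $b$ if it is the intersection graph of a family of axis-parallel boxes $[\ell_1,r_1]\times\dots\times[\ell_b,r_b]$ in $\mathbb{R}^b$ (one per vertex, adjacency iff the boxes intersect). *)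

(* Defs.v *)
From HB Require Import structures.
From mathcomp Require Import all_boot all_order all_algebra.
From mathcomp Require Import boolp classical_sets reals.

Set Implicit Arguments.
Unset Strict Implicit.
Unset Printing Implicit Defensive.

Import Order.TTheory GRing.Theory Num.Theory.

(* A binary word is a [seq bool]; [false] is the letter 0, [true] the letter 1. *)
Definition uniform_word (k : nat) (w : seq bool) : bool :=
  (count_mem false w == k) && (count_mem true w == k).

Definition uniform_language (k : nat) (L : pred (seq bool)) : Prop :=
  forall w, L w -> uniform_word k w.

Record sym_language := SymLanguage {
  language :> pred (seq bool);
  language_swap : forall w, language (map negb w) = language w }.

(* The letter at position [i] of [w] is its [occurrence w i]-th occurrence,
   counted from 1; the default of [nth] is irrelevant when [i < size w]. *)
Definition occurrence (w : seq bool) (i : nat) : nat :=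
  count_mem (nth false w i) (take i.+1 w).

(* [delta k w] is $\delta_{k,k}^{2b}(w)$; the value does not depend on b.
   Only k >= 1 is meaningful. *)
Definition delta (k : nat) (w : seq bool) : seq bool :=
  mask [seq occurrence w i \in [:: 2 * k - 1; 2 * k] | i <- iota 0 (size w)] w.

Definition overlap_words : seq (seq bool) :=
  [:: [:: false; true; false; true]; [:: true; false; true; false];
      [:: false; true; true; false]; [:: true; false; false; true] ].

Definition box_pred (b : nat) : pred (seq bool) := fun w =>
  [&& count_mem false w == 2 * b, count_mem true w == 2 * b
    & all (fun k => delta k w \in overlap_words) (iota 1 b)].

Lemma delta_swap k w : delta k (map negb w) = map negb (delta k w).
Proof.
rewrite /delta size_map map_mask; congr mask.
apply/eq_in_map => i; rewrite mem_iota add0n => /= ltiw.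
rewrite /occurrence (nth_map false) // -map_take count_map.
by rewrite (@eq_count _ _ (pred1 (nth false w i))) // => x /=; rewrite (inj_eq negb_inj).
Qed.

Lemma box_pred_swap b w : box_pred b (map negb w) = box_pred b w.
Proof.
rewrite /box_pred !count_map.
rewrite (@eq_count _ (preim negb (pred1 false)) (pred1 true)); last by move=> [].
rewrite (@eq_count _ (preim negb (pred1 true)) (pred1 false)); last by move=> [].
rewrite andbCA; congr [&& _, _ & _]; apply: eq_all => k.
rewrite delta_swap -[RHS](mem_map (inj_map negb_inj)) !inE.
by rewrite [LHS]orbCA [in LHS](orbC (_ == [:: false; true; true; false])).
Qed.

Definition box_language (b : nat) : sym_language :=
  SymLanguage (box_pred_swap b).

Record sgraph := SGraph {
  vertex :> finType;
  edge : rel vertex;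
  edge_sym : symmetric edge;
  edge_irr : irreflexive edge }.

Definition isomorphic (G H : sgraph) : Prop :=
  exists2 f : G -> H, bijective f & forall u v, edge (f u) (f v) = edge u v.

Section WordGraph.
Variables (L : sym_language) (A : choiceType) (w : seq A).

Definition proj (a b : A) (s : seq A) : seq bool :=
  pmap (fun x => if x == a then Some false
                 else if x == b then Some true else None) s.

Lemma proj_swap a b s : a != b -> proj b a s = map negb (proj a b s).
Proof.
move=> neab; elim: s => //= x s ->.
case: (eqVneq x a) => [->|_]; first by rewrite (negbTE neab).
by case: eqP.
Qed.

(* The vertices are the letters that occur in [w]. *)
Definition word_edge : rel (seq_sub w) :=
  fun u v => (u != v) && L (proj (val u) (val v) w).

Lemma word_edge_sym : symmetric word_edge.
Proof.
move=> u v; rewrite /word_edge eq_sym; case: eqVneq => //= nevu.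
by rewrite (@proj_swap (val v) (val u)) ?(inj_eq val_inj) // language_swap.
Qed.

Lemma word_edge_irr : irreflexive word_edge.
Proof. by move=> u; rewrite /word_edge eqxx. Qed.

Definition word_graph : sgraph := SGraph word_edge_sym word_edge_irr.

End WordGraph.

Definition word_graph_class (L : sym_language) (G : sgraph) : Prop :=
  exists (A : choiceType) (w : seq A), isomorphic G (word_graph L w).

Section Boxicity.
Variable R : realType.
Local Open Scope ring_scope.
Local Open Scope classical_set_scope.

Definition box (b : nat) (l r : 'rV[R]_b) : set 'rV[R]_b :=
  [set x | forall i, l ord0 i <= x ord0 i <= r ord0 i].

Definition boxicity_le (b : nat) (G : sgraph) : Prop :=
  exists l r : G -> 'rV[R]_b,
    (forall v i, l v ord0 i <= r v ord0 i) /\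
    (forall u v, u != v ->
       (edge u v <-> box (l u) (r u) `&` box (l v) (r v) !=set0)).

End Boxicity.

(* Main.v *)
(* The k-th pair of occurrences of a letter is read as an interval of positions,
   the k-th side of a box. Among the words with two 0s and two 1s, the overlap
   words exclude exactly 0011 and 1100, so [delta k w] fails to be one iff some
   prefix of w contains the k-th interval of one letter and has not yet met that
   of the other. This turns a word into boxes whose coordinates are positions.
   Conversely, sorting the endpoints of the sides along each axis, left ends
   first among equal values, and concatenating these words over the axes
   represents the intersection graph of given boxes. *)

Require Import Defs.
From mathcomp Require Import all_boot all_order all_algebra.
From mathcomp Require Import classical_sets reals.
From mathcomp Require Import zify.

Set Implicit Arguments.
Unset Strict Implicit.
Unset Printing Implicit Defensive.

Import Order.TTheory GRing.Theory Num.Theory.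

(** * Separating prefixes and [delta] *)

(* The axis index [k] starts from 0, whereas that of [delta] starts from 1. *)
Definition separated (T : eqType) (a c : T) (k : nat) (w : seq T) : Prop :=
  exists p, [/\ prefix p w, 2 * k + 2 <= count_mem a p
              & count_mem c p <= 2 * k].

(** Whether an occurrence is kept depends only on the prefix that ends with it, so [delta] can be
    built letter by letter and respects prefixes. *)
Lemma delta_rcons k s x :
  delta k (rcons s x) =
  delta k s ++ nseq (count_mem x (rcons s x) \in [:: 2 * k - 1; 2 * k]) x.
Proof.
rewrite -cats1 /delta size_cat iotaD map_cat.
rewrite mask_cat ?size_map ?size_iota //; congr (mask _ _ ++ _).
  apply/eq_in_map => i; rewrite mem_iota add0n => /= ltis.
  by rewrite /occurrence nth_cat ltis takel_cat.
rewrite /= /occurrence nth_cat ltnn subnn take_oversize ?size_cat ?addn1 //=.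
by case: (_ \in _).
Qed.

Lemma prefix_delta k p s : prefix p s -> prefix (delta k p) (delta k s).
Proof.
move/prefixP => [q ->]; elim/last_ind: q => [|q x IHq]; first by rewrite cats0 prefix_refl.
by rewrite -rcons_cat delta_rcons; apply/(prefix_trans IHq)/prefix_prefix.
Qed.

(** The truncated subtraction gives 0 until an occurrence beyond number [2 * k] is met. *)
Lemma count_delta k s x :
  count_mem x (delta k.+1 s) = minn (count_mem x s) (2 * k + 2) - 2 * k.
Proof.
elim/last_ind: s => [|s y IHs] //; first by rewrite min0n.
rewrite delta_rcons count_cat IHs -!cats1 !count_cat /= !inE eqxx.
by have [->|neyx] := eqVneq y x; rewrite count_nseq /= ?eqxx ?(negbTE neyx); lia.
Qed.

Lemma size_count_negb (s : seq bool) x :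
  size s = count_mem x s + count_mem (~~ x) s.
Proof.
by rewrite -(count_predC (pred1 x)); congr addn; apply: eq_count; case: x => -[].
Qed.

Lemma size2_counts (s : seq bool) x :
  count_mem x s = 2 -> count_mem (~~ x) s = 0 -> s = [:: x; x].
Proof.
move=> cx cnx; have := size_count_negb s x; rewrite cx cnx.
by case: s cx {cnx} => [|y [|z [|t s]]] //; case: x; case: y; case: z.
Qed.

(** By [count_delta], the separating prefixes are those that [delta] sends to [[:: x; x]]; the
    induction finds the shortest one. *)
Lemma take2_delta k s x :
  take 2 (delta k.+1 s) = [:: x; x] <-> separated x (~~ x) k s.
Proof.
split=> [|[p [pre_p le_x le_nx]]]; last first.
  have dp : delta k.+1 p = [:: x; x].
    by apply: size2_counts; rewrite count_delta; lia.
  by move: (prefix_delta k.+1 pre_p); rewrite dp prefixE => /eqP.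
elim/last_ind: s => [|s y IHs] // take2.
have [le2|lt2] := leqP 2 (size (delta k.+1 s)).
  have [|p [pre_p le_x le_nx]] := IHs.
    by rewrite -take2 delta_rcons takel_cat.
  by exists p; split=> //; apply: prefix_trans pre_p (prefix_rcons _ _).
(* Here [delta k.+1 s] has at most one letter and [y] adds at most one, so [take 2] removes
   nothing. *)
have drc : delta k.+1 (rcons s y) = [:: x; x].
  rewrite -take2 take_oversize // delta_rcons size_cat size_nseq.
  by case: (_ \in _) => /=; lia.
have := count_delta k (rcons s y) x; have := count_delta k (rcons s y) (~~ x).
rewrite drc /= eqxx (_ : (x == ~~ x) = false); last by case: (x).
by move=> cnx cx; exists (rcons s y); split=> /=; [exact: prefix_refl|lia|lia].
Qed.

(** Of the six words with two letters of each kind, only 0011 and 1100 begin with a repeated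
    letter. *)
Lemma overlap_words_take2 (s : seq bool) :
  count_mem false s = 2 -> count_mem true s = 2 ->
  s \in overlap_words <->
  take 2 s <> [:: false; false] /\ take 2 s <> [:: true; true].
Proof.
move=> c0 c1; have := size_count_negb s false; rewrite c0 c1.
case: s c0 c1 => [|x [|y [|z [|t [|? ?]]]]] //=.
by case: x; case: y; case: z; case: t => //= _ _ _; split=> // -[].
Qed.

Lemma delta_overlap k s :
  2 * k + 2 <= count_mem false s -> 2 * k + 2 <= count_mem true s ->
  delta k.+1 s \in overlap_words <->
  ~ separated false true k s /\ ~ separated true false k s.
Proof.
move=> c0 c1; rewrite -(take2_delta _ _ false) -(take2_delta _ _ true).
by apply: overlap_words_take2; rewrite count_delta; lia.
Qed.

(** * Projection onto two letters *)

Lemma prefix_pmap (T U : eqType) (f : T -> option U) (s : seq T) p :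
  prefix p (pmap f s) <-> exists2 q, prefix q s & p = pmap f q.
Proof.
split=> [|[q /prefixP[t ->] ->]]; last by rewrite pmap_cat prefix_prefix.
elim: s p => [|x s IHs] p /=; first by case: p => // _; exists [::].
case fx: (f x) => [y|] /= pre_p; last first.
  have [q pre_q ->] := IHs _ pre_p.
  by exists (x :: q); rewrite /= ?eqxx ?fx.
case: p pre_p => [|z p] /=; first by exists [::].
case/andP=> /eqP-> /IHs[q pre_q ->].
by exists (x :: q); rewrite /= ?eqxx ?fx.
Qed.

Lemma count_proj (A : choiceType) (a c : A) (w : seq A) : a != c ->
  (count_mem false (proj a c w) = count_mem a w) *
  (count_mem true (proj a c w) = count_mem c w).
Proof.
move=> neac; elim: w => //= x w [IHa IHc].
have [->|neca] := eqVneq x a; first by rewrite (negbTE neac) /= IHa IHc.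
by case: (x == c); rewrite /= IHa IHc.
Qed.

(** Prefixes of the projection are the projections of prefixes of [w], and [proj] keeps the counts
    of both letters. *)
Lemma separated_proj (A : choiceType) (a c : A) k (w : seq A) : a != c ->
  (separated false true k (proj a c w) <-> separated a c k w) /\
  (separated true false k (proj a c w) <-> separated c a k w).
Proof.
move=> neac; split; split=> [[p []]|[p [pre_p]]].
- by case/prefix_pmap=> q ? ->; rewrite !count_proj //; exists q.
- exists (proj a c p); rewrite !count_proj //; split=> //.
  by apply/prefix_pmap; exists p.
- by case/prefix_pmap=> q ? ->; rewrite !count_proj //; exists q.
- exists (proj a c p); rewrite !count_proj //; split=> //.
  by apply/prefix_pmap; exists p.
Qed.

Lemma box_pred_proj (A : choiceType) b (a c : A) (w : seq A) : a != c ->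
  box_pred b (proj a c w) <->
  [/\ count_mem a w = 2 * b, count_mem c w = 2 * b
    & forall k, k < b -> ~ separated a c k w /\ ~ separated c a k w].
Proof.
move=> neac; rewrite /box_pred !count_proj //.
have over k : k < b -> count_mem a w = 2 * b -> count_mem c w = 2 * b ->
    delta k.+1 (proj a c w) \in overlap_words <->
    ~ separated a c k w /\ ~ separated c a k w.
  move=> ltkb ca cc; have [<- <-] := separated_proj k w neac.
  by apply: delta_overlap; rewrite count_proj //; lia.
split=> [/and3P[/eqP ca /eqP cc /allP all_b]|[ca cc nsep]].
  split=> // k ltkb; apply/over=> //; apply: all_b; rewrite mem_iota; lia.
rewrite ca cc !eqxx; apply/allP => -[|k]; rewrite mem_iota // => ltkb.
by apply/over => //; apply: nsep.
Qed.

(** * Positions of occurrences *)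

Section Position.
Variables (A : eqType) (w : seq A).

(** This is the length of the shortest prefix with [n] occurrences of [a]. A failing [find] returns
    [size w], which is the right value when only the whole word has enough of them. *)
Definition position (a : A) (n : nat) : nat :=
  find (fun i => n <= count_mem a (take i w)) (iota 0 (size w)).

Lemma position_leq_size a n : position a n <= size w.
Proof. by rewrite -[leqRHS](size_iota 0) find_size. Qed.

Lemma leq_count_take (a : A) i j :
  i <= j -> count_mem a (take i w) <= count_mem a (take j w).
Proof.
move=> leij; rewrite -(cat_take_drop i (take j w)) take_takel // count_cat.
exact: leq_addr.
Qed.

(** An adjunction between lengths of prefixes and numbers of occurrences, used from here on in place
    of [find]. *)
Lemma position_leq a n i :
  n <= count_mem a w -> (position a n <= i) = (n <= count_mem a (take i w)).
Proof.
move=> len; rewrite /position; set P := fun j => _.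
apply/idP/idP => [lei|Pi].
  apply: leq_trans (leq_count_take a lei).
  have [hasP|hasNP] := boolP (has P (iota 0 (size w))).
    have := nth_find 0 hasP; rewrite nth_iota //.
    by rewrite -[ltnRHS](size_iota 0) -has_find.
  (* No proper prefix suffices, so the prefix in question is [w] itself. *)
  by rewrite hasNfind // size_iota take_size.
rewrite leqNgt; apply/negP => lti.
have := before_find 0 lti; rewrite nth_iota ?/P ?Pi //.
by apply: leq_trans lti _; rewrite -[leqRHS](size_iota 0) find_size.
Qed.

Lemma position_mono a m n :
  m <= n -> n <= count_mem a w -> position a m <= position a n.
Proof.
move=> lemn len; rewrite position_leq ?(leq_trans lemn) //.
by rewrite -position_leq.
Qed.

(** Among the prefixes with enough [a], the shortest has the fewest [c], so it alone has to be
    tested. *)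
Lemma separated_position a c k :
  2 * k + 2 <= count_mem a w -> 2 * k + 1 <= count_mem c w ->
  separated a c k w <-> position a (2 * k + 2) < position c (2 * k + 1).
Proof.
move=> ca cc; split=> [[p []]|lt_pos].
  rewrite prefixE => /eqP <-; rewrite -position_leq // => lea lec.
  by apply: leq_ltn_trans lea _; rewrite ltnNge position_leq //; lia.
exists (take (position a (2 * k + 2)) w); split; first exact: prefix_take.
  by rewrite -position_leq.
by move: lt_pos; rewrite ltnNge position_leq //; lia.
Qed.

End Position.

(** * Letters as boxes of positions *)

Section LetterCoordinates.
Variables (A : choiceType) (w : seq A) (b : nat).

(* A letter that does not occur exactly [2 * b] times is an isolated vertex:
   it gets a point of its own beyond all positions of [w]. *)
Definition letter_coord (a : A) (n : nat) : nat :=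
  if count_mem a w == 2 * b then position w a n else size w + 1 + index a w.

Lemma letter_coord_mono a k :
  k < b -> letter_coord a (2 * k + 1) <= letter_coord a (2 * k + 2).
Proof.
rewrite /letter_coord => ltkb; case: eqP => // ca.
by apply: position_mono; rewrite ?ca; lia.
Qed.

Lemma box_pred_letter_coord a c :
    0 < b -> a \in w -> c \in w -> a != c ->
  box_pred b (proj a c w) <->
  forall k, k < b ->
    letter_coord a (2 * k + 1) <= letter_coord c (2 * k + 2) /\
    letter_coord c (2 * k + 1) <= letter_coord a (2 * k + 2).
Proof.
move=> b_gt0 aw cw neac; rewrite box_pred_proj //.
split=> [[ca cc nsep] k ltkb|meet].
  have [nac nca] := nsep k ltkb; rewrite /letter_coord ca cc eqxx.
  by split; rewrite leqNgt; apply/negP => lt_pos; [apply: nca|apply: nac];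
     apply/separated_position; rewrite ?ca ?cc //; lia.
(* A wrong count puts the letter at a point beyond [size w], hence beyond all positions, and
   distinct letters get distinct points; axis 0 already shows that the two sides are disjoint. *)
have [ca cc] : count_mem a w = 2 * b /\ count_mem c w = 2 * b.
  have [] := meet 0 b_gt0; rewrite /letter_coord.
  have neq_index : index a w <> index c w.
    by move/(index_inj a aw cw); apply/eqP.
  have := position_leq_size w a (2 * 0 + 2).
  have := position_leq_size w c (2 * 0 + 2).
  by case: eqP => ca; case: eqP => cc //= *; lia.
split=> // k ltkb; have := meet k ltkb.
rewrite /letter_coord ca cc eqxx => -[le_ac le_ca].
by split; rewrite separated_position ?ca ?cc; lia.
Qed.

End LetterCoordinates.

(** * Concatenation of one word per axis *)

Lemma prefix_count (T : eqType) (a : pred T) (p s : seq T) :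
  prefix p s -> count a p <= count a s.
Proof. by move/prefixP=> [q ->]; rewrite count_cat leq_addr. Qed.

Lemma prefix_cat_split (T : eqType) (p s t : seq T) :
  prefix p (s ++ t) -> prefix p s \/ exists2 q, prefix q t & p = s ++ q.
Proof.
elim: s p => [|x s IHs] [|y p] //=; first by right; exists [::].
- by right; exists (y :: p).
- by left.
case/andP=> /eqP-> /IHs[->|[q pre_q ->]]; first by left; rewrite eqxx.
by right; exists q.
Qed.

Lemma count_flatten2 (T : eqType) (a : T) (W : nat -> seq T) m n :
  (forall j, count_mem a (W j) = 2) ->
  count_mem a (flatten [seq W j | j <- iota m n]) = 2 * n.
Proof.
by move=> W2; elim: n m => //= n IHn m; rewrite count_cat IHn W2; lia.
Qed.

(** The blocks before block [k] use up exactly [2 * k] occurrences of each letter, so a separating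
    prefix has to end inside block [k]. *)
Lemma separated_flatten (T : eqType) (a c : T) (W : nat -> seq T) m n k :
    (forall j x, count_mem x (W j) = 2) -> k < n ->
  separated a c k (flatten [seq W j | j <- iota m n]) <->
  separated a c 0 (W (m + k)).
Proof.
move=> W2; elim: n m k => // n IHn m [|k] ltkn /=.
  rewrite addn0; split=> -[p [pre_p lea lec]]; exists p; split=> //; last first.
    exact/(prefix_trans pre_p)/prefix_prefix.
  case/prefix_cat_split: pre_p => // -[q _ dp].
  by move: lec; rewrite dp count_cat W2; lia.
rewrite addnS -addSn -IHn //; split=> -[p [pre_p lea lec]].
  case/prefix_cat_split: pre_p => [/(prefix_count (pred1 a))|[q pre_q dp]].
    by rewrite W2; lia.
  by move: lea lec; rewrite dp !count_cat !W2 => lea lec; exists q; split=> //; lia.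
exists (W m ++ p); rewrite !count_cat !W2; split; try lia.
by rewrite prefix_catr // eqxx.
Qed.

(** * Sorted endpoints on one axis *)

Section SortedEndpoints.
Variables (R : realType) (V : finType) (lo hi : V -> R).
Hypothesis lo_le_hi : forall v, (lo v <= hi v)%R.

(* The endpoint [(false, v)] is [lo v] and [(true, v)] is [hi v]; at equal
   values left endpoints come first, so that touching closed intervals overlap. *)
Definition endpoint_key (e : bool * V) : R *l bool :=
  ((if e.1 then hi e.2 else lo e.2), e.1).

Definition endpoint_le (e f : bool * V) : bool :=
  (endpoint_key e <= endpoint_key f)%O.

Definition endpoints : seq (bool * V) := sort endpoint_le (enum {: bool * V}).

Definition endpoint_word : seq V := [seq e.2 | e <- endpoints].

Lemma mem_endpoints e : e \in endpoints.
Proof. by rewrite mem_sort mem_enum. Qed.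

Lemma count_snd (t : seq (bool * V)) v : uniq t ->
  count_mem v [seq e.2 | e <- t] = ((false, v) \in t) + ((true, v) \in t).
Proof.
elim: t => //= -[s x] t IHt /andP[xt uniq_t]; rewrite IHt // !inE.
have [<-|nexv] := eqVneq x v.
  by case: s xt => /negbTE xt; rewrite xt !xpair_eqE !eqxx /=; lia.
by rewrite !xpair_eqE ![v == x]eq_sym (negbTE nexv) !andbF.
Qed.

Lemma uniq_endpoints : uniq endpoints.
Proof. by rewrite sort_uniq enum_uniq. Qed.

Lemma count_endpoint_word v : count_mem v endpoint_word = 2.
Proof. by rewrite count_snd ?uniq_endpoints // !mem_endpoints. Qed.

Lemma index_endpoints_le e f :
  index e endpoints <= index f endpoints -> endpoint_le e f.
Proof.
have tr : transitive endpoint_le by move=> x y z; apply: le_trans.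
apply: (sorted_leq_index tr) => [x||//|//]; rewrite ?mem_endpoints //.
- exact: lexx.
- by apply: sort_sorted => x y; apply: le_total.
Qed.

Lemma separated_endpoint_word u v :
  separated u v 0 endpoint_word <-> (hi u < lo v)%R.
Proof.
have mem_take i e : (e \in take i endpoints) = (index e endpoints < i).
  by rewrite in_take ?mem_endpoints.
have count_take i x : count_mem x (take i endpoint_word) =
    (index (false, x) endpoints < i) + (index (true, x) endpoints < i).
  by rewrite -map_take count_snd ?take_uniq ?uniq_endpoints // !mem_take.
split=> [[p []]|lt_uv].
  rewrite prefixE => /eqP <-; rewrite !count_take => ltu ltv.
  have /index_endpoints_le : index (true, u) endpoints <= index (false, v) endpoints.
    by lia.
  (* At equal values the left end of [v] would precede the right end of [u]; this makes the
     inequality strict. *)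
  rewrite /endpoint_le /endpoint_key lexi_pair /= => /andP[le_uv].
  by rewrite implybF -ltNge.
have le_uu : index (false, u) endpoints <= index (true, u) endpoints.
  rewrite leqNgt; apply/negP => /ltnW/index_endpoints_le.
  rewrite /endpoint_le /endpoint_key lexi_pair /= => /andP[_].
  by rewrite lo_le_hi.
have lt_v s : index (true, u) endpoints < index (s, v) endpoints.
  rewrite ltnNge; apply/negP => /index_endpoints_le.
  rewrite /endpoint_le /endpoint_key lexi_pair /= => /andP[le_vu _].
  have: (lo v <= hi u)%R by case: s le_vu => //; apply: le_trans.
  by rewrite leNgt lt_uv.
(* Cut just after the right end of [u]: both ends of [u] have been met, and both ends of [v] come
   later. *)
exists (take (index (true, u) endpoints).+1 endpoint_word).
rewrite prefix_take !count_take !ltnS le_uu leqnn; split=> //.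
by rewrite ![index (_, v) _ <= _]leqNgt !lt_v.
Qed.

End SortedEndpoints.

(** * Boxes and word graphs *)

Section Boxes.
Local Open Scope ring_scope.
Local Open Scope classical_set_scope.

(** On each axis the larger of the two left ends lies in both intervals. *)
Lemma box_meet (R : realType) b (l r l' r' : 'rV[R]_b) :
    (forall i, l ord0 i <= r ord0 i) -> (forall i, l' ord0 i <= r' ord0 i) ->
  box l r `&` box l' r' !=set0 <->
  forall i, l ord0 i <= r' ord0 i /\ l' ord0 i <= r ord0 i.
Proof.
move=> lr lr'; split=> [[x [bx bx']] i|meet].
  have /andP[? ?] := bx i; have /andP[? ?] := bx' i.
  by split; apply: (@le_trans _ _ (x ord0 i)).
exists (\row_i Num.max (l ord0 i) (l' ord0 i)).
by split=> i; rewrite mxE le_max ge_max lexx ?orbT ?lr ?lr' ?(meet i).1 ?(meet i).2.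
Qed.

Lemma boxicity_le_isomorphic (R : realType) b (G H : sgraph) :
  isomorphic G H -> boxicity_le R b H -> boxicity_le R b G.
Proof.
move=> [f /bij_inj f_inj f_edge] [l [r [lr edge_lr]]].
exists (l \o f), (r \o f); split=> [v i|u v neuv]; first exact: lr.
by rewrite -f_edge edge_lr ?(inj_eq f_inj).
Qed.

Lemma word_graph_boxicity_le (R : realType) b (A : choiceType) (w : seq A) :
  (0 < b)%N -> boxicity_le R b (word_graph (box_language b) w).
Proof.
move=> b_gt0; pose coord := letter_coord w b.
pose l (u : seq_sub w) : 'rV[R]_b := \row_i (coord (val u) (2 * i + 1)%N)%:R.
pose r (u : seq_sub w) : 'rV[R]_b := \row_i (coord (val u) (2 * i + 2)%N)%:R.
have lr u i : l u ord0 i <= r u ord0 i.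
  by rewrite !mxE ler_nat letter_coord_mono.
exists l, r; split=> // u v neuv.
rewrite box_meet // /edge /= /word_edge neuv /=.
rewrite box_pred_letter_coord ?(valP u) ?(valP v) //; split=> [meet i|meet k ltkb].
  by rewrite !mxE !ler_nat; apply: meet.
by have := meet (Ordinal ltkb); rewrite !mxE !ler_nat.
Qed.

(** The vertices of [G] serve as letters; in both graphs a non-edge means that on some axis one side
    ends before the other begins. *)
Lemma boxicity_le_word_graph (R : realType) b (G : sgraph) :
  (0 < b)%N -> boxicity_le R b G -> word_graph_class (box_language b) G.
Proof.
(* The successor form lets [inord] turn the block number [j] into an axis. *)
case: b => // b _ [l [r [lr edge_lr]]].
pose W j := endpoint_word (fun v => l v ord0 (inord j))
                          (fun v => r v ord0 (inord j)).
have W2 j x : count_mem x (W j) = 2 by apply: count_endpoint_word.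
pose w := flatten [seq W j | j <- iota 0 b.+1].
have cw v : count_mem v w = (2 * b.+1)%N by apply: count_flatten2.
(* The word graph has only the letters of [w] as vertices, so each vertex of [G] must occur; there
   is at least one axis. *)
have mem_w v : v \in w by rewrite -has_pred1 has_count cw.
have sep u v (i : 'I_b.+1) :
    separated u v i w <-> r u ord0 i < l v ord0 i.
  rewrite separated_flatten // add0n -{2 3}(inord_val i).
  by apply: separated_endpoint_word => x.
exists G, w, (fun v => SeqSub (mem_w v)).
  by exists val => [v|v] //; apply: val_inj.
move=> u v; rewrite [LHS]/edge /= /word_edge -(inj_eq val_inj) /=.
have [->|neuv] := eqVneq u v; first by rewrite edge_irr.
apply/idP/idP.
  case/(box_pred_proj _ _ neuv) => _ _ nsep.
  apply/edge_lr => //; apply/box_meet => // i.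
  have [nuv nvu] := nsep i (ltn_ord i).
  by rewrite !leNgt; split; apply/negP => /sep.
move/edge_lr => /(_ neuv) /box_meet meet; apply/box_pred_proj => //.
split=> // k ltkb; have [] := meet (lr u) (lr v) (Ordinal ltkb).
by rewrite !leNgt => nvu nuv; split=> /(sep _ _ (Ordinal ltkb)); apply/negP.
Qed.

End Boxes.

Theorem theorem4 (R : realType) (b : nat) (hb : (1 <= b)%N) :
  uniform_language (2 * b) (box_language b) /\
  (forall G : sgraph,
     word_graph_class (box_language b) G <-> boxicity_le R b G).
Proof.
split=> [w /and3P[c0 c1 _]|G]; first by rewrite /uniform_word c0 c1.
split=> [[A [w isoG]]|]; last exact: boxicity_le_word_graph.
exact/(boxicity_le_isomorphic isoG)/word_graph_boxicity_le.
Qed.
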